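(* Let $p<q$ be primes. For every positive integer $b$, $p \mid \mathrm{B}(pq^{b})$.
   Context: The height $\mathrm{H}(f)$ of a polynomial $f\in\mathbb{Z}[x]$ is the largest absolute value of its coefficients. For a positive integer $n$, $\mathrm{B}(n):=\max\{\mathrm{H}(f) : f\in\mathbb{Z}[x],\ f \mid x^{n}-1\}$. *)

(* Defs.v *)
From mathcomp Require Import all_boot all_order all_algebra all_field.
From mathcomp Require Import boolp classical_sets.

Set Implicit Arguments.
Unset Strict Implicit.
Unset Printing Implicit Defensive.

Import Order.TTheory GRing.Theory Num.Theory.
Local Open Scope ring_scope.

Definition height (f : {poly int}) : nat := \max_(i < size f) `|(f`_i)%R|%N.

(* Divisibility in Z[x] itself.  The relation %| of polydiv is based on
   pseudo-division and over int amounts to divisibility in Q[x]: it would let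
   every nonzero integer multiple of a divisor count as a divisor. *)
Definition dvdpZ (f h : {poly int}) : Prop := exists g, h = f * g.

Definition divisor_heights (n : nat) : set nat :=
  [set height f | f in [set f | dvdpZ f ('X^n - 1)]].

Definition is_max (A : set nat) (m : nat) : Prop :=
  A m /\ forall k, A k -> (k <= m)%N.

(* The default value 0 is used only for n = 0, where no maximum exists;
   see B_spec. *)
Definition B (n : nat) : nat := xget 0%N [set m | is_max (divisor_heights n) m].

Lemma coef_prod_unit_bound (r : seq algC) (i : nat) :
  (forall z, z \in r -> `|z| = 1) ->
  `|(\prod_(z <- r) ('X - z%:P))`_i| <= (2 ^ size r)%:R :> algC.
Proof.
elim: r i => [|z r IH] i Hr.
  by rewrite big_nil coef1; case: (i == 0)%N; rewrite ?normr1 ?normr0 ?ler01.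
have Hz : `|z| = 1 by apply: Hr; rewrite mem_head.
have {}IH j : `|(\prod_(z <- r) ('X - z%:P))`_j| <= (2 ^ size r)%:R :> algC.
  by apply: IH => w wr; apply: Hr; rewrite inE wr orbT.
rewrite big_cons mulrBl coefB coefXM coefCM.
apply: le_trans (ler_normB _ _) _.
rewrite normrM Hz mul1r /= expnS mul2n -addnn natrD.
apply: lerD (IH i).
by case: (i == 0)%N; rewrite ?normr0 ?ler0n ?IH.
Qed.

Lemma height_dvd_bound (n : nat) (f : {poly int}) :
  (0 < n)%N -> dvdpZ f ('X^n - 1) -> (height f <= 2 ^ n)%N.
Proof.
move=> n0 [g fg].
have Hm : ('X^n - 1 : {poly int}) != 0.
  by rewrite -size_poly_eq0 size_XnsubC.
have f0 : f != 0 by apply: contraNneq Hm => f0; rewrite fg f0 mul0r.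
have g0 : g != 0 by apply: contraNneq Hm => g0; rewrite fg g0 mulr0.
have lf : `|lead_coef f|%N = 1%N.
  have: lead_coef f * lead_coef g = 1.
    by rewrite -lead_coefM -fg (monicP (monicXnsubC 1 n0)).
  move=> /(congr1 absz); rewrite abszM => /eqP.
  by rewrite muln_eq1 => /andP[/eqP].
pose F : {poly algC} := map_poly intr f.
have sF : size F = size f by rewrite size_map_inj_poly ?rmorph0 //; exact: intr_inj.
have [r Fr] := closed_field_poly_normal F.
have lF : lead_coef F = (lead_coef f)%:~R.
  by rewrite lead_coef_map_inj ?rmorph0 //; exact: intr_inj.
have nlF : `|lead_coef F| = 1 by rewrite lF -intr_norm -abszE lf.
have lF0 : lead_coef F != 0 by rewrite -normr_eq0 nlF oner_eq0.
have sr : (size r <= n)%N.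
  have : (size f <= n.+1)%N.
    rewrite -(size_XnsubC (1 : int) n0) fg size_mul // .
    by rewrite -(prednK (n:=size g)) ?size_poly_gt0 // addnS leq_addr.
  by rewrite -sF Fr size_scale // size_prod_XsubC.
have Hr z : z \in r -> `|z| = 1.
  move=> zr.
  have Fz : F.[z] = 0.
    by rewrite Fr hornerZ (rootP _) ?mulr0 // root_prod_XsubC.
  have : (map_poly intr ('X^n - 1 : {poly int})).[z] = 0 :> algC.
    by rewrite fg rmorphM hornerM -/F Fz mul0r.
  rewrite rmorphB rmorph1 /= map_polyXn !hornerE => /eqP.
  rewrite subr_eq0 => /eqP zn.
  by apply/eqP; rewrite -(@pexpr_eq1 _ _ n) // -normrX zn normr1.
apply/bigmax_leqP => i _.
rewrite -(ler_nat algC).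
have -> : (`|(f`_i)%R|%N)%:R = `|F`_i| :> algC.
  by rewrite coef_map -intr_norm -abszE.
rewrite Fr coefZ normrM nlF mul1r.
apply: le_trans (coef_prod_unit_bound _ Hr) _.
by rewrite ler_nat leq_exp2l.
Qed.

Lemma B_spec (n : nat) : (0 < n)%N -> is_max (divisor_heights n) (B n).
Proof.
move=> n0; rewrite /B.
pose P k := `[< divisor_heights n k >].
have exP : exists k, P k.
  by exists (height 1); apply/asboolP; exists 1 => //; exists ('X^n - 1); rewrite mul1r.
have ubP k : P k -> (k <= 2 ^ n)%N.
  by move=> /asboolP[f Hf <-]; exact: height_dvd_bound.
case: (ex_maxnP exP ubP) => m /asboolP Pm mmax.
apply: (@xgetPex _ 0%N [set m | is_max (divisor_heights n) m]).
by exists m; split=> // k Hk; apply: mmax; apply/asboolP.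
Qed.

(* Main.v *)
(* Irreducibility of the cyclotomic polynomials shows that every divisor of
   x^(p q^(b+1)) - 1 is f1(x) R(x^q), with f1 dividing x^(pq) - 1 and
   (x^p - 1) R(x) dividing x^(p q^b) - 1.  In each such f1 the coefficients
   whose indices lie in a given class modulo q have absolute values summing to
   at most p, so f1(x) R(x^q) has height at most p H(R).  On the other hand
   Phi_p(x) Phi_q(x) R(x^q) is again a divisor, and p times each coefficient of
   R occurs among its coefficients.  Taking for f1(x) R(x^q) a divisor of
   maximal height gives B(p q^(b+1)) = p H(R). *)
Require Import Defs.
From mathcomp Require Import all_boot all_order all_algebra all_field.
From mathcomp Require Import zify ring.

Set Implicit Arguments.
Unset Strict Implicit.
Unset Printing Implicit Defensive.

Import Order.TTheory GRing.Theory Num.Theory.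
Local Open Scope ring_scope.

Local Notation pZtoC := (map_poly (intr : int -> algC)).

(** * Divisors in Z[x] and cyclotomic factors *)

(** Division by the monic ['Phi_n] leaves an integral remainder that vanishes at [z] and has smaller
    degree than the minimal polynomial of [z], hence is zero. *)
Lemma Cyclotomic_dvd (n : nat) (z : algC) (f : {poly int}) :
  n.-primitive_root z -> root (pZtoC f) z -> dvdpZ 'Phi_n f.
Proof.
move=> prim_z fz; have mPhi := Cyclotomic_monic n.
have Phiz : root (pZtoC 'Phi_n) z.
  by rewrite (Cintr_Cyclotomic prim_z) root_cyclotomic.
exists (Pdiv.Ring.rdivp f 'Phi_n).
have E := Pdiv.RingMonic.rdivp_eq mPhi f.
set r := Pdiv.Ring.rmodp f 'Phi_n in E.
suff r0 : r = 0 by rewrite {1}E r0 addr0 mulrC.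
have rz : root (pZtoC r) z.
  move: fz; rewrite {1}E rmorphD rmorphM rootE hornerD hornerM /=.
  by rewrite (rootP Phiz) mulr0 add0r.
have [m [mE mm mroot]] := minCpolyP z.
pose rQ : {poly rat} := map_poly intr r.
have rQC : map_poly ratr rQ = pZtoC r.
  by rewrite -map_poly_comp; apply: eq_map_poly => x /=; rewrite ratr_int.
have: m %| rQ by rewrite -mroot rQC.
move/dvdp_leq; case: (eqVneq rQ 0) => [rQ0 _|_ /(_ isT)].
  apply: (@map_inj_poly _ _ (intr : int -> rat)) => //; first exact: intr_inj.
  by rewrite rmorph0.
(* Irreducibility enters here: the minimal polynomial of [z] over Q is the cyclotomic polynomial. *)
have -> : size m = size 'Phi_n.
  by rewrite -(size_map_poly (ratr : rat -> algC)) -mE (minCpoly_cyclotomic prim_z)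
    size_cyclotomic size_Cyclotomic.
rewrite size_map_inj_poly ?rmorph0 //; last exact: intr_inj.
by rewrite leqNgt Pdiv.Ring.ltn_rmodpN0 // monic_neq0.
Qed.

Lemma Cyclotomic_dvdM (n : nat) (f g : {poly int}) : (0 < n)%N ->
  dvdpZ 'Phi_n (f * g) -> dvdpZ 'Phi_n f \/ dvdpZ 'Phi_n g.
Proof.
move=> n0 [h fgh]; have [z prim_z] := C_prim_root_exists n0.
have: root (pZtoC (f * g)) z.
  by rewrite fgh rmorphM rootM /= (Cintr_Cyclotomic prim_z) root_cyclotomic prim_z.
by rewrite rmorphM rootM => /orP[] /(Cyclotomic_dvd prim_z); [left | right].
Qed.

(** Each ['Phi_d] is prime, so it can be cancelled either from [f], and then [d] joins [t], or from
    the cofactor of [f]. What remains divides [P]. *)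
Lemma dvd_mul_prod_Cyclotomic (P f : {poly int}) (s : seq nat) :
  all (leq 1) s -> dvdpZ f (P * \prod_(d <- s) 'Phi_d) ->
  exists f1 t, [/\ dvdpZ f1 P, subseq t s & f = f1 * \prod_(d <- t) 'Phi_d].
Proof.
elim: s P f => [|d s IH] P f /=.
  by rewrite big_nil mulr1 => _ fP; exists f, [::]; rewrite big_nil mulr1.
move=> /andP[d0 s0] [g fg].
have Phi0 : 'Phi_d != 0 := monic_neq0 (Cyclotomic_monic d).
have: dvdpZ 'Phi_d (f * g).
  by exists (P * \prod_(i <- s) 'Phi_i); rewrite -fg big_cons mulrCA.
case/(Cyclotomic_dvdM d0) => -[h hE].
  have [|f1 [t [f1P ts hE']]] := IH P h s0.
    exists g; apply: (mulfI Phi0).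
    by rewrite [RHS]mulrA -hE -fg big_cons; ring.
  exists f1, (d :: t); split=> //=; first by rewrite eqxx.
  by rewrite hE hE' big_cons; ring.
have [|f1 [t [f1P ts fE]]] := IH P f s0.
  exists h; apply: (mulfI Phi0).
  by move: fg; rewrite hE big_cons => E; rewrite mulrCA [RHS]mulrCA -E; ring.
by exists f1, t; split=> //; apply: subseq_trans (subseq_cons _ _).
Qed.

(** * Substituting x^q into cyclotomic polynomials *)

Lemma totientM_dvd (q n : nat) : prime q -> (0 < n)%N -> (q %| n)%N ->
  totient (n * q) = (q * totient n)%N.
Proof.
move=> pq n0 qn; have [m cm nE] := pfactor_coprime pq n0.
have e0 : (0 < logn q n)%N by rewrite logn_gt0 mem_primes pq n0.
rewrite nE -mulnA -expnSr !totient_coprime ?coprimeXr ?(coprime_sym m) ?coprimeXl //.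
rewrite !totient_pfactor //= -[in LHS](prednK e0) expnS.
by rewrite mulnCA (mulnCA q) mulnCA; congr (_ * _)%N; rewrite mulnCA.
Qed.

(** If [z] is a primitive root of order [n * q], then [z ^+ q] has order [n], so ['Phi_(n * q)]
    divides the left side. Both are monic, and [totientM_dvd] makes their degrees equal. *)
Lemma Cyclotomic_comp_Xn (q n : nat) : prime q -> (0 < n)%N -> (q %| n)%N ->
  'Phi_n \Po 'X^q = 'Phi_(n * q).
Proof.
move=> pq n0 qn; have q0 := prime_gt0 pq.
have nq0 : (0 < n * q)%N by rewrite muln_gt0 n0.
have [z prim_z] := C_prim_root_exists nq0.
have prim_zq : n.-primitive_root (z ^+ q).
  by have := exp_prim_root prim_z q; rewrite gcdnMl mulnK.
have mC : 'Phi_n \Po 'X^q \is monic.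
  rewrite monicE lead_coef_comp ?size_polyXn ?ltnS // lead_coefXn expr1n mulr1.
  exact: Cyclotomic_monic.
have [|h hE] := @Cyclotomic_dvd (n * q) z ('Phi_n \Po 'X^q) prim_z.
  rewrite map_comp_poly map_polyXn root_comp hornerXn (Cintr_Cyclotomic prim_zq).
  by rewrite root_cyclotomic.
have sC : size ('Phi_n \Po 'X^q) = size 'Phi_(n * q).
  have := size_comp_poly 'Phi_n ('X^q).
  rewrite size_polyXn !size_Cyclotomic /= (mulnC (totient n)) -totientM_dvd // => sE.
  rewrite -sE prednK // lt0n size_poly_eq0.
  exact: monic_neq0.
have mh : h \is monic by rewrite -(monicMl _ (Cyclotomic_monic (n * q))) -hE.
have sh : size h = 1%N.
  have := size_monicM (Cyclotomic_monic (n * q)) (monic_neq0 mh).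
  rewrite -hE sC size_Cyclotomic addSn /= => sE.
  by apply: (@addnI (totient (n * q))); rewrite -sE addn1.
move: mh; rewrite monicE lead_coefE sh => /eqP h0.
by rewrite hE (size1_polyC (eq_leq sh)) h0 mulr1.
Qed.

(** * Factorisation of x^(p q^b) - 1 and of its divisors *)

Lemma prod_Cyclotomic_prime (p : nat) : prime p -> 'X^p - 1 = 'Phi_1 * 'Phi_p.
Proof.
move=> pp; have [u _ dE] := divisors_correct (prime_gt0 pp).
have perm_dvd : perm_eq (divisors p) [:: 1%N; p].
  apply: uniq_perm => //= [|d]; first by rewrite inE neq_ltn prime_gt1.
  rewrite dE !inE; apply/idP/idP => [dp|/orP[]/eqP->]; rewrite ?dvd1n //.
  by move/primeP: pp => [_ H]; exact: H.
rewrite -prod_Cyclotomic ?prime_gt0 //.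
by rewrite (perm_big _ perm_dvd) !big_cons big_nil /= mulr1.
Qed.

Lemma prod_Cyclotomic_primeM (p q : nat) : prime p -> prime q -> (p < q)%N ->
  'X^(p * q) - 1 = 'Phi_1 * 'Phi_p * 'Phi_q * 'Phi_(p * q).
Proof.
move=> pp pq ltpq; have pq0 : (0 < p * q)%N by rewrite muln_gt0 !prime_gt0.
have [u _ dE] := divisors_correct pq0; have p1 := prime_gt1 pp.
have dvdp1 e : (e %| p)%N -> e = 1%N \/ e = p.
  by move/primeP: pp => [_ H] /H /orP[]/eqP; [left | right].
have perm_dvd : perm_eq (divisors (p * q)) [:: 1%N; p; q; (p * q)%N].
  apply: uniq_perm => //= [|d]; first by rewrite !inE; nia.
  rewrite dE !inE; apply/idP/idP => [|/or4P[]/eqP->]; last first.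
  - exact: dvdnn.
  - exact: dvdn_mull.
  - exact: dvdn_mulr.
  - exact: dvd1n.
  have [/dvdnP[e ->]|qd] := boolP (q %| d)%N.
    rewrite dvdn_pmul2r ?prime_gt0 // => /dvdp1[] ->.
      by rewrite mul1n eqxx ?orbT.
    by rewrite eqxx ?orbT.
  rewrite Gauss_dvdl ?(coprime_sym d) ?prime_coprime // => /dvdp1[] ->.
    by rewrite eqxx.
  by rewrite eqxx orbT.
rewrite -prod_Cyclotomic // (perm_big _ perm_dvd) !big_cons big_nil /=.
by rewrite mulr1 !mulrA.
Qed.

(** The divisors of [p * q ^ b] that are multiples of [q]. The recursion mirrors the substitution of
    x^q, which multiplies these orders by [q]. *)
Fixpoint upper_orders (p q b : nat) : seq nat :=
  if b is b'.+1 then [:: q, (p * q)%N & [seq (d * q)%N | d <- upper_orders p q b']]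
  else [::].

Lemma all_upper_orders (p q b : nat) : prime p -> prime q ->
  all (fun d => (0 < d) && (q %| d))%N (upper_orders p q b).
Proof.
move=> pp pq; have q0 := prime_gt0 pq; have p0 := prime_gt0 pp.
elim: b => //= b /allP IH; rewrite q0 dvdnn muln_gt0 p0 q0 dvdn_mull //=.
by apply/allP => _ /mapP[d /IH /andP[d0 qd] ->]; rewrite muln_gt0 d0 q0 dvdn_mulr.
Qed.

Lemma prod_Cyclotomic_comp_Xn (q : nat) (s : seq nat) : prime q ->
  all (fun d => (0 < d) && (q %| d))%N s ->
  (\prod_(d <- s) 'Phi_d) \Po 'X^q = \prod_(d <- [seq (d * q)%N | d <- s]) 'Phi_d.
Proof.
move=> pq; elim: s => [|d s IH] /=; first by rewrite !big_nil comp_polyC.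
move=> /andP[/andP[d0 qd] /IH {}IH].
by rewrite !big_cons comp_polyM IH Cyclotomic_comp_Xn.
Qed.

Lemma Xn_sub1_comp (m q : nat) : ('X^m - 1) \Po 'X^q = 'X^(m * q) - 1 :> {poly int}.
Proof. by rewrite comp_polyB comp_polyC comp_Xn_poly -exprM mulnC. Qed.

Lemma Xn_sub1_upper_orders (p q b : nat) : prime p -> prime q -> (p < q)%N ->
  'X^(p * q ^ b) - 1 = ('X^p - 1) * \prod_(d <- upper_orders p q b) 'Phi_d.
Proof.
move=> pp pq ltpq; elim: b => [|b IH]; first by rewrite /= big_nil muln1 mulr1.
rewrite expnSr mulnA -Xn_sub1_comp IH comp_polyM Xn_sub1_comp /= !big_cons.
rewrite (prod_Cyclotomic_comp_Xn pq (all_upper_orders b pp pq)).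
by rewrite prod_Cyclotomic_primeM // prod_Cyclotomic_prime // !mulrA.
Qed.

(** Beyond x^(pq) - 1, all cyclotomic factors have the form ['Phi_d \Po 'X^q] with [d] in
    [upper_orders p q b]. Those kept in [f] form R(x^q). Since [R] uses only these [d], the factor
    x^p - 1 of x^(p q^b) - 1 stays available next to it. *)
Lemma dvd_Xn_sub1_split (p q b : nat) (f : {poly int}) :
  prime p -> prime q -> (p < q)%N -> dvdpZ f ('X^(p * q ^ b.+1) - 1) ->
  exists f1 R, [/\ dvdpZ f1 ('X^(p * q) - 1),
    dvdpZ (('X^p - 1) * R) ('X^(p * q ^ b) - 1) & f = f1 * (R \Po 'X^q)].
Proof.
move=> pp pq ltpq; set s := upper_orders p q b.
have s_ok : all (fun d => (0 < d) && (q %| d))%N s by exact: all_upper_orders.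
have -> : 'X^(p * q ^ b.+1) - 1 =
    ('X^(p * q) - 1) * \prod_(d <- [seq (d * q)%N | d <- s]) 'Phi_d :> {poly int}.
  rewrite expnSr mulnA -Xn_sub1_comp Xn_sub1_upper_orders // comp_polyM.
  by rewrite Xn_sub1_comp (prod_Cyclotomic_comp_Xn pq s_ok).
case/dvd_mul_prod_Cyclotomic => [|f1 [t [f1P /subseqP[m sm ->] ->]]].
  apply/allP => _ /mapP[d /(allP s_ok) /andP[d0 _] ->].
  by rewrite muln_gt0 d0 prime_gt0.
rewrite size_map in sm.
exists f1, (\prod_(d <- mask m s) 'Phi_d); split=> //; last first.
  rewrite -map_mask prod_Cyclotomic_comp_Xn //.
  by apply/allP => d /mem_mask /(allP s_ok).
rewrite Xn_sub1_upper_orders // -/s.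
have [h ->] : dvdpZ (\prod_(d <- mask m s) 'Phi_d) (\prod_(d <- s) 'Phi_d).
  elim: {s_ok} s m sm => [|d s IH] [|a m] //= => [_|[/IH[h hE]]].
    by exists 1; rewrite mulr1.
  rewrite big_cons hE; case: a; last by exists ('Phi_d * h); ring.
  by exists h; rewrite big_cons mulrA.
by exists h; rewrite mulrA.
Qed.

Lemma dvdpZ1 (u : {poly int}) : dvdpZ u 1 -> u = 1 \/ u = -1.
Proof.
move=> [g ug]; have : u \is a GRing.unit by apply/unitrPr; exists g.
rewrite poly_unitE => /andP[/eqP su]; rewrite (size1_polyC (eq_leq su)) coefC eqxx.
by rewrite unfold_in /= => /orP[]/eqP->; [left | right; rewrite polyCN].
Qed.

Lemma dvd_Xpq_sub1 (p q : nat) (f : {poly int}) :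
  prime p -> prime q -> (p < q)%N -> dvdpZ f ('X^(p * q) - 1) ->
  exists (e a c a' c' : bool), f = (-1) ^+ e * ('Phi_1 ^+ a * 'Phi_p ^+ c *
    ('Phi_q ^+ a' * 'Phi_(p * q) ^+ c')).
Proof.
move=> pp pq ltpq.
have -> : 'X^(p * q) - 1 = 1 * \prod_(d <- [:: 1%N; p; q; (p * q)%N]) 'Phi_d.
  by rewrite prod_Cyclotomic_primeM // !big_cons big_nil mul1r mulr1 !mulrA.
case/dvd_mul_prod_Cyclotomic => [|u [t [uP /subseqP[m sm ->] ->]]].
  by rewrite /= muln_gt0 !prime_gt0.
case: m sm => [|a [|c [|a' [|c' []]]]] //= _.
have [e ->] : exists e : bool, u = (-1) ^+ e.
  by case/dvdpZ1: uP => ->; [exists false | exists true].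
exists e, a, c, a', c'; congr (_ * _).
by case: a; case: c; case: a'; case: c';
  rewrite ?big_cons ?big_nil /= ?expr0 ?expr1 ?mul1r ?mulr1 ?mulrA.
Qed.

(** * Coefficient bounds by residue class modulo q *)

Lemma coef_le_height (f : {poly int}) (i : nat) : `|f`_i| <= (height f)%:Z.
Proof.
have [lti|gei] := ltnP i (size f); last by rewrite nth_default ?normr0.
rewrite -abszE lez_nat.
exact: (leq_bigmax (F := fun i : 'I_(size f) => `|(f`_i)%R|%N) (Ordinal lti)).
Qed.

Lemma height_leP (f : {poly int}) (m : nat) :
  (forall i, `|f`_i| <= m%:Z) -> (height f <= m)%N.
Proof. by move=> H; apply/bigmax_leqP => i _; rewrite -lez_nat abszE. Qed.

(* Stands for: the coefficients of [W] with index congruent to [n] modulo [q]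
   have absolute values summing to at most [w n]. *)
Definition class_bound (q : nat) (w : nat -> nat) (W : {poly int}) : Prop :=
  forall R n, `|(W * (R \Po 'X^q))`_n| <= (w n * height R)%:Z.

Lemma class_bound_le (q : nat) (w w' : nat -> nat) (W : {poly int}) :
  (forall n, w n <= w' n)%N -> class_bound q w W -> class_bound q w' W.
Proof.
move=> ww H R n; apply: le_trans (H R n) _.
by rewrite lez_nat leq_mul2r ww orbT.
Qed.

Lemma class_boundXn (q m : nat) : (0 < q)%N ->
  class_bound q (fun n => n == m %[mod q]) 'X^m.
Proof.
move=> q0 R n; rewrite coefXnM coef_comp_poly_Xn //.
case: ltnP => [_|lemn]; first by rewrite normr0.
rewrite eqn_mod_dvd //; case: ifP => _; last by rewrite normr0.
by rewrite mul1n coef_le_height.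
Qed.

Lemma class_boundD (q : nat) (w1 w2 : nat -> nat) (W1 W2 : {poly int}) :
  class_bound q w1 W1 -> class_bound q w2 W2 ->
  class_bound q (fun n => w1 n + w2 n)%N (W1 + W2).
Proof.
move=> H1 H2 R n; rewrite mulrDl coefD mulnDl PoszD.
by apply: le_trans (ler_normD _ _) _; apply: lerD.
Qed.

Lemma class_boundN (q : nat) (w : nat -> nat) (W : {poly int}) :
  class_bound q w W -> class_bound q w (- W).
Proof. by move=> H R n; rewrite mulNr coefN normrN. Qed.

Lemma class_boundB (q : nat) (w1 w2 : nat -> nat) (W1 W2 : {poly int}) :
  class_bound q w1 W1 -> class_bound q w2 W2 ->
  class_bound q (fun n => w1 n + w2 n)%N (W1 - W2).
Proof. by move=> H1 /class_boundN; exact: class_boundD. Qed.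

Lemma class_bound_sum (q k : nat) (w : nat -> nat -> nat) (W : nat -> {poly int}) :
  (forall i, (i < k)%N -> class_bound q (w i) (W i)) ->
  class_bound q (fun n => \sum_(i < k) w i n)%N (\sum_(i < k) W i).
Proof.
elim: k => [|k IH] H.
  by move=> R n; rewrite !big_ord0 mul0r coef0 normr0 mul0n.
move=> R n; rewrite !big_ord_recr.
have IHk := IH (fun i ik => H i (ltnW ik)).
exact: class_boundD IHk (H k (ltnSn k)) R n.
Qed.

Lemma class_bound_shift (q c m : nat) (W : {poly int}) :
  class_bound q (fun=> c) W -> class_bound q (fun=> c) ('X^m * W).
Proof.
move=> H R n; rewrite -mulrA coefXnM; case: ifP => _; last exact: H.
by rewrite normr0.
Qed.

(** * Cyclotomic polynomials of orders p and pq as geometric sums *)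

Definition geom (k m : nat) : {poly int} := \sum_(i < k) 'X^(i * m).

Lemma geomE (k m : nat) : 'X^(k * m) - 1 = ('X^m - 1) * geom k m.
Proof.
rewrite mulnC exprM subrX1; congr (_ * _).
by apply: eq_bigr => i _; rewrite mulnC exprM.
Qed.

Lemma Cyclotomic1 : 'Phi_1 = 'X - 1.
Proof.
have := @prod_Cyclotomic 1 isT; rewrite expr1 => <-.
by rewrite (_ : divisors 1 = [:: 1%N]) // big_seq1.
Qed.

Lemma Xn_sub1_neq0 (n : nat) : (0 < n)%N -> 'X^n - 1 != 0 :> {poly int}.
Proof. by move=> n0; rewrite monic_neq0 // monicXnsubC. Qed.

Lemma Cyclotomic_prime (p : nat) : prime p -> 'Phi_p = geom p 1.
Proof.
move=> pp; apply: (mulfI (Xn_sub1_neq0 (ltn0Sn 0))).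
by rewrite -geomE muln1 (prod_Cyclotomic_prime pp) Cyclotomic1 expr1.
Qed.

Lemma Cyclotomic_primeMr (p q : nat) : prime p -> prime q -> (p < q)%N ->
  'Phi_q * 'Phi_(p * q) = geom q p.
Proof.
move=> pp pq ltpq; apply: (mulfI (Xn_sub1_neq0 (prime_gt0 pp))).
by rewrite -geomE (mulnC q) (prod_Cyclotomic_primeM pp pq ltpq)
  (prod_Cyclotomic_prime pp) !mulrA.
Qed.

Lemma Cyclotomic_primeMl (p q : nat) : prime p -> prime q -> (p < q)%N ->
  'Phi_p * 'Phi_(p * q) = geom p q.
Proof.
move=> pp pq ltpq; apply: (mulfI (Xn_sub1_neq0 (prime_gt0 pq))).
by rewrite -geomE (prod_Cyclotomic_primeM pp pq ltpq) (prod_Cyclotomic_prime pq); ring.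
Qed.

(** The hypotheses give m p = l' q + 1 and l q = m' p + 1. Multiplying both sides by (x - 1)(x^p -
    1)(x^q - 1) leaves combinations of monomials whose exponents match by these relations. *)
Lemma Cyclotomic_primeM (p q m l m' l' : nat) : prime p -> prime q -> (p < q)%N ->
  (m + m' = q)%N -> (l + l' = p)%N -> (l' * q + 1 = m * p)%N ->
  'Phi_(p * q) = geom m p * geom l q - 'X * (geom m' p * geom l' q).
Proof.
move=> pp pq ltpq mq lp lm.
have p0 := prime_gt0 pp; have q0 := prime_gt0 pq.
apply: (mulfI (Xn_sub1_neq0 p0)); apply: (mulfI (Xn_sub1_neq0 q0)).
apply: (mulfI (Xn_sub1_neq0 (ltn0Sn 0))).
have -> : ('X^1 - 1) * (('X^q - 1) * (('X^p - 1) * 'Phi_(p * q))) =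
   ('X - 1) * ('X - 1) * ('X^(p * q) - 1) :> {poly int}.
  rewrite prod_Cyclotomic_primeM // (prod_Cyclotomic_prime pp).
  by rewrite (prod_Cyclotomic_prime pq) Cyclotomic1; ring.
have -> : ('X^1 - 1) * (('X^q - 1) * (('X^p - 1) *
     (geom m p * geom l q - 'X * (geom m' p * geom l' q)))) =
   ('X - 1) * (('X^(m * p) - 1) * ('X^(l * q) - 1)
     - 'X * (('X^(m' * p) - 1) * ('X^(l' * q) - 1))) :> {poly int}.
  by rewrite !geomE; ring.
have u'E : 'X * 'X^(m' * p) = 'X^(l * q) :> {poly int}.
  by rewrite -exprS; congr 'X^_; nia.
have v'E : 'X * 'X^(l' * q) = 'X^(m * p) :> {poly int}.
  by rewrite -exprS; congr 'X^_; nia.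
have uv : 'X^(m * p) * 'X^(l * q) = 'X * 'X^(p * q) :> {poly int}.
  by rewrite -exprS -exprD; congr 'X^_; nia.
have uv' : 'X^(m' * p) * 'X^(m * p) = 'X^(p * q) :> {poly int}.
  by rewrite -exprD; congr 'X^_; nia.
rewrite -mulrA; congr (_ * _).
rewrite [RHS](_ : _ = 'X^(m * p) * 'X^(l * q) - 'X^(m * p) - 'X^(l * q) + 1
  - 'X^(m' * p) * ('X * 'X^(l' * q)) + 'X * 'X^(m' * p) + 'X * 'X^(l' * q) - 'X);
  last by ring.
by rewrite uv u'E v'E uv'; ring.
Qed.

(** * Index windows and bounds for geometric products *)

(** As [m] is invertible modulo [q], the multiples of [m] by at most [q] consecutive integers lie in
    distinct classes. *)
Lemma window_count (q m a b n : nat) : coprime q m -> (b <= a + q)%N ->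
  (\sum_(a <= i < b) (n == i * m %[mod q]) <= 1)%N.
Proof.
move=> cqm; elim: b => [|b IH] ltb; first by rewrite big_geq.
have [leab|ltba] := leqP a b; last by rewrite big_geq.
rewrite big_nat_recr //=; case: (boolP (n == b * m %[mod q])) => [nb|_]; last first.
  by rewrite addn0; apply/IH/ltnW.
rewrite big_nat big1 // => i /andP[lei ltib].
rewrite (eqP nb) eqn_mod_dvd ?leq_mul2r ?(ltnW ltib) ?orbT // -mulnBl Gauss_dvdl //.
by case: (boolP (_ %| _)%N) => // /dvdn_leq; lia.
Qed.

Lemma window_count_cat (q m a b c d n : nat) : coprime q m ->
  (a <= b)%N -> (b <= c)%N -> (c <= d)%N -> (d <= a + q)%N ->
  (\sum_(a <= i < b) (n == i * m %[mod q]) +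
   \sum_(c <= i < d) (n == i * m %[mod q]) <= 1)%N.
Proof.
move=> cqm ab bc cd da; apply: leq_trans (window_count n cqm da).
rewrite [X in (_ <= X)%N](big_cat_nat ab) /=; last by lia.
by rewrite leq_add2l [X in (_ <= X)%N](big_cat_nat bc) //= leq_addl.
Qed.

(** The exponents e + i p + j q lie in the class of (c + i) p, whatever [j] is; hence the factor
    [l]. Writing [e] as a multiple of [p] modulo [q] turns the shift by [e] into a translation of
    the index window. *)
Lemma class_bound_block (q p c e m l : nat) : (0 < q)%N -> e = c * p %[mod q] ->
  class_bound q (fun n => l * \sum_(c <= i < c + m) (n == i * p %[mod q]))%N
    ('X^e * (geom m p * geom l q)).
Proof.
move=> q0 ec.
have -> : 'X^e * (geom m p * geom l q) =
    \sum_(i < m) \sum_(j < l) 'X^(e + i * p + j * q).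
  rewrite /geom big_distrlr big_distrr; apply: eq_bigr => i _.
  by rewrite big_distrr; apply: eq_bigr => j _ /=; rewrite !exprD mulrA.
apply: (@class_bound_le _ (fun n => \sum_(i < m) \sum_(j < l)
    (n == e + i * p + j * q %[mod q]))%N).
  move=> n; rewrite -[X in index_iota X]add0n [(c + m)%N]addnC big_addn addnK.
  rewrite big_mkord big_distrr leq_sum // => i _.
  rewrite -[X in (_ <= X * _)%N]card_ord -sum_nat_const leq_sum // => j _.
  by rewrite (addnC (e + _)%N) modnMDl -modnDml ec modnDml -mulnDl addnC.
apply: (@class_bound_sum q m
  (fun i n => \sum_(j < l) (n == e + i * p + j * q %[mod q]))%N
  (fun i => \sum_(j < l) 'X^(e + i * p + j * q))) => i _.
apply: (@class_bound_sum q l (fun j n => n == e + i * p + j * q %[mod q] : nat)%N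
  (fun j => 'X^(e + i * p + j * q))) => j _.
exact: class_boundXn.
Qed.

Lemma class_bound1 (q : nat) : (0 < q)%N -> class_bound q (fun=> 1%N) 1.
Proof.
move=> q0; apply: class_bound_le (class_boundXn 0 q0) => n.
by case: (_ == _).
Qed.

Lemma class_bound_geom (q p m : nat) : coprime q p -> (0 < q)%N -> (m <= q)%N ->
  class_bound q (fun=> 1%N) (geom m p).
Proof.
move=> cqp q0 mq.
apply: class_bound_le (@class_bound_sum q m _ (fun i => 'X^(i * p))
  (fun i _ => class_boundXn (i * p) q0)) => n.
by rewrite -(big_mkord xpredT (fun i => (n == i * p %[mod q]) : nat)) window_count.
Qed.

Lemma class_bound_geomM (q k m c : nat) (W : {poly int}) :
  class_bound q (fun=> c) W -> class_bound q (fun=> k * c)%N (geom k m * W).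
Proof.
move=> H; rewrite /geom big_distrl /=.
apply: class_bound_le
  (@class_bound_sum q k (fun _ _ => c) (fun i => 'X^(i * m) * W) _).
  by move=> n; rewrite sum_nat_const card_ord.
by move=> i _; exact: class_bound_shift.
Qed.

Lemma class_bound_Xn_sub1M (q m c : nat) (W : {poly int}) :
  class_bound q (fun=> c) W -> class_bound q (fun=> 2 * c)%N (('X^m - 1) * W).
Proof.
move=> H; rewrite mulrBl mul1r.
apply: class_bound_le (class_boundB (class_bound_shift m H) H) => n.
by rewrite mul2n -addnn.
Qed.

Lemma class_bound_X_sub1 (q : nat) : (1 < q)%N -> class_bound q (fun=> 1%N) ('X - 1).
Proof.
move=> q1; have q0 := ltnW q1.
apply: class_bound_le (class_boundB (class_boundXn 1 q0) (class_boundXn 0 q0)) => n.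
rewrite mod0n (modn_small q1); have [->|_] := eqVneq (n %% q)%N 1%N; first by [].
by rewrite add0n leq_b1.
Qed.

(** * Class bound p for every divisor of x^(pq) - 1 *)

(** The possible factors x^p - 1, x - 1, ['Phi_p] and 1 multiply the bound by 2, 2, p and 1, none
    above [p]. *)
Lemma class_bound_Phi1_Phip (p q : nat) (a c : bool) (W : {poly int}) :
  prime p -> prime q -> class_bound q (fun=> 1%N) W ->
  class_bound q (fun=> p) ('Phi_1 ^+ a * 'Phi_p ^+ c * W).
Proof.
move=> pp pq H; have p1 := prime_gt1 pp.
case: a; case: c; rewrite ?expr1 ?expr0 ?mul1r ?mulr1.
- rewrite -prod_Cyclotomic_prime //.
  by apply: class_bound_le (class_bound_Xn_sub1M p H) => n.
- rewrite Cyclotomic1 -['X]expr1.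
  by apply: class_bound_le (class_bound_Xn_sub1M 1 H) => n.
- rewrite Cyclotomic_prime //; apply: class_bound_le (class_bound_geomM p 1 H) => n.
  by rewrite muln1.
- by apply: class_bound_le H => n; exact: ltnW.
Qed.

Lemma bezout_primes (p q : nat) : prime p -> prime q -> (p < q)%N ->
  exists m l m' l', [/\ m + m' = q, l + l' = p & l' * q + 1 = m * p]%N.
Proof.
move=> pp pq ltpq.
have /eqP gcd1 : coprime p q.
  by rewrite prime_coprime // dvdn_prime2 // neq_ltn ltpq.
case: (egcdnP q (prime_gt0 pp)) => m l'; rewrite gcd1 muln1 => lm ltl'.
have ltm : (m < q)%N by nia.
by exists m, (p - l')%N, (q - m)%N, l'; split; lia.
Qed.

Lemma class_bound_Phipq (p q : nat) : prime p -> prime q -> (p < q)%N ->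
  class_bound q (fun=> p) 'Phi_(p * q) /\
  class_bound q (fun=> p) (('X - 1) * 'Phi_(p * q)).
Proof.
move=> pp pq ltpq; have q0 := prime_gt0 pq; have p1 := prime_gt1 pp.
have cqp : coprime q p by rewrite prime_coprime // dvdn_prime2 // gtn_eqF.
have [m [l [m' [l' [mq lp lm]]]]] := bezout_primes pp pq ltpq.
have PhiE := Cyclotomic_primeM pp pq ltpq mq lp lm.
(* Since m p is 1 modulo [q], multiplication by ['X] translates an index window by [m]. *)
have e1 : 1 = m * p %[mod q] by rewrite -lm modnMDl.
have e2 : 2 = (m + m) * p %[mod q] by rewrite mulnDl -lm -modnDm modnMDl modnDm.
pose A := geom m p * geom l q; pose A' := geom m' p * geom l' q.
have := @class_bound_block q p 0 0 m l q0 erefl; rewrite expr0 mul1r => cA.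
have cXA := @class_bound_block q p m 1 m l q0 e1.
have cXA' := @class_bound_block q p m 1 m' l' q0 e1.
have cX2A' := @class_bound_block q p (m + m) 2 m' l' q0 e2.
(* The four index windows occurring in (X - 1) * A and (X - 1) * X * A' are
   translates modulo q of [0, m), [m, 2m), [m, q) and [2m, q + m).  Each class
   meets the first and third, and the second and fourth, at most once in all;
   it meets the first two both only if q < 2m, when 2l <= p, and the last two
   both only if 2m < q, when 2l' <= p. *)
pose N a b n := (\sum_(a <= i < b) (n == i * p %[mod q]))%N.
split.
  (* The windows [0, m) and [m, q) are disjoint, so a class meets at most one of them, with weight
     [l] or [l'], both at most [p]. *)
  rewrite PhiE -['X]expr1; apply: class_bound_le (class_boundB cA cXA') => n.
  have := @window_count_cat q p 0 m m (m + m') n cqp.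
  rewrite -/(N _ _ _) -/(N 0 m n) /= !add0n; nia.
have -> : ('X - 1) * 'Phi_(p * q) =
    ('X^1 * A - 'X^2 * A') + ('X^1 * A' - A) by rewrite PhiE -/A -/A'; ring.
apply: class_bound_le (class_boundD (class_boundB cXA cX2A') (class_boundB cXA' cA)) => n.
rewrite -/(N m (m + m)%N n) -/(N (m + m) (m + m + m') n)%N -/(N m (m + m') n)%N.
rewrite -/(N 0 (0 + m) n)%N add0n.
have H1 : (N 0 m n + N m (m + m') n <= 1)%N by apply: window_count_cat; lia.
have H2 : (N m (m + m) n + N (m + m) (m + m + m') n <= 1)%N.
  by apply: window_count_cat; lia.
have H3 : (m + m <= q)%N -> (N 0 m n + N m (m + m) n <= 1)%N.
  by move=> ?; apply: window_count_cat; lia.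
have H4 : (q <= m + m)%N -> (N m (m + m') n + N (m + m) (m + m + m') n <= 1)%N.
  by move=> ?; apply: window_count_cat; lia.
(* From l q = m' p + 1 with 2m' < q for [L1], and from l' q = m p - 1 for [L2]. *)
have L1 : (q < m + m)%N -> (l + l <= p)%N by nia.
have L2 : (m + m < q)%N -> (l' + l' <= p)%N by nia.
move: (N _ _ _) (N _ _ _) (N _ _ _) (N _ _ _) H1 H2 H3 H4.
clear -L1 L2 lp; case: (ltngtP q (m + m)) L1 L2 => _ L1 L2.
- by move=> [|[|?]] [|[|?]] [|[|?]] [|[|?]]; lia.
- by move=> [|[|?]] [|[|?]] [|[|?]] [|[|?]]; lia.
- by move=> [|[|?]] [|[|?]] [|[|?]] [|[|?]]; lia.
Qed.

(** ['Phi_q], ['Phi_q * 'Phi_(p * q)] and 1 have bound 1, and the factors ['Phi_1], ['Phi_p] raise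
    it to at most [p]. If ['Phi_(p * q)] occurs without ['Phi_q], then ['Phi_p * 'Phi_(p * q)] is a
    sum of [p] monomials, each multiplying 1 or x - 1, both of bound 1; without ['Phi_p],
    [class_bound_Phipq] applies. *)
Lemma class_bound_dvd_Xpq_sub1 (p q : nat) (f : {poly int}) :
  prime p -> prime q -> (p < q)%N -> dvdpZ f ('X^(p * q) - 1) ->
  class_bound q (fun=> p) f.
Proof.
move=> pp pq ltpq /(dvd_Xpq_sub1 pp pq ltpq)[e [a [c [a' [c' ->]]]]].
have q0 := prime_gt0 pq; have q1 := prime_gt1 pq.
have cqp : coprime q p by rewrite prime_coprime // dvdn_prime2 // gtn_eqF.
suff: class_bound q (fun=> p)
    ('Phi_1 ^+ a * 'Phi_p ^+ c * ('Phi_q ^+ a' * 'Phi_(p * q) ^+ c')).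
  by case: e => H; rewrite ?expr0 ?expr1 ?mul1r ?mulN1r //; exact: class_boundN.
case: a' => [|]; rewrite ?expr1 ?expr0 ?mul1r.
  apply: class_bound_Phi1_Phip => //; case: c'; rewrite ?expr1 ?expr0 ?mulr1.
    by rewrite Cyclotomic_primeMr //; exact: class_bound_geom.
  by rewrite Cyclotomic_prime //; apply: class_bound_geom; rewrite ?coprimen1.
case: c'; rewrite ?expr1 ?expr0.
  have [cPhi cX1Phi] := class_bound_Phipq pp pq ltpq.
  case: c; rewrite ?expr1 ?expr0 ?mulr1.
    rewrite -mulrA Cyclotomic_primeMl // mulrC.
    apply: (@class_bound_le _ (fun=> p * 1)%N); first by move=> n; rewrite muln1.
    apply: class_bound_geomM; case: a; rewrite ?expr1 ?expr0.
      by rewrite Cyclotomic1; exact: class_bound_X_sub1.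
    exact: class_bound1.
  by case: a; rewrite ?expr1 ?expr0 ?mul1r ?Cyclotomic1.
by apply: class_bound_Phi1_Phip => //; exact: class_bound1.
Qed.

(** * Comparison of the maximal height with p H(R) *)

Lemma height_class_bound (q c : nat) (f R : {poly int}) :
  class_bound q (fun=> c) f -> (height (f * (R \Po 'X^q)) <= c * height R)%N.
Proof. by move=> H; apply: height_leP => i; exact: H. Qed.

Lemma coef_geom1M (k n : nat) (f : {poly int}) :
  (geom k 1 * f)`_n = \sum_(i < k | (i <= n)%N) f`_(n - i).
Proof.
rewrite /geom big_distrl coef_sum [RHS]big_mkcond; apply: eq_bigr => i _ /=.
by rewrite muln1 coefXnM ltnNge; case: (i <= n)%N.
Qed.

(** Among [q] consecutive indices ending at [n] only n - (n mod q) is a multiple of [q]. *)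
Lemma coef_geom_comp (q n : nat) (R : {poly int}) : (0 < q)%N ->
  (geom q 1 * (R \Po 'X^q))`_n = R`_(n %/ q).
Proof.
move=> q0; rewrite coef_geom1M (bigD1 (Ordinal (ltn_pmod n q0))) ?leq_mod //=.
rewrite coef_comp_poly_Xn // -eqn_mod_dvd ?leq_mod // modn_mod eqxx.
rewrite big1 ?addr0 => [|i /andP[lein neqi]].
  by rewrite {1}(divn_eq n q) addnK mulnK.
rewrite coef_comp_poly_Xn // -eqn_mod_dvd //; case: ifP => // /eqP E.
by move: neqi; rewrite -val_eqE /= E modn_small // eqxx.
Qed.

(** Multiplying R(x^q) by ['Phi_q] repeats each coefficient of [R] on a block of [q] indices, and
    ['Phi_p] then sums [p] consecutive entries. *)
Lemma leq_height_PhipPhiq (p q : nat) (R : {poly int}) :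
  prime p -> prime q -> (p < q)%N ->
  (p * height R <= height ('Phi_p * 'Phi_q * (R \Po 'X^q)))%N.
Proof.
move=> pp pq ltpq; set F := _ * (R \Po 'X^q).
have q0 := prime_gt0 pq; have p0 := prime_gt0 pp.
rewrite mulnC -leq_divRL //; apply: height_leP => k.
(* The [p] entries summed at this index are the first [p] of block [k], which is long enough as p <
   q. *)
suff Fk : F`_(k * q + p.-1) = R`_k *+ p.
  rewrite -abszE lez_nat leq_divRL // -lez_nat PoszM abszE.
  by have := coef_le_height F (k * q + p.-1); rewrite Fk normrMn -mulr_natr natz.
rewrite /F -mulrA !Cyclotomic_prime // coef_geom1M.
rewrite (eq_bigl xpredT) => [|i]; last by have := ltn_ord i; lia.
rewrite (eq_bigr (fun=> R`_k)) => [|i _]; first by rewrite sumr_const card_ord.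
have ltip := ltn_ord i; rewrite coef_geom_comp // -addnBA; last by lia.
by rewrite divnMDl // divn_small ?addn0 //; lia.
Qed.

Lemma B_eq_height (p q b : nat) : prime p -> prime q -> (p < q)%N ->
  exists R : {poly int}, B (p * q ^ b.+1) = (p * height R)%N.
Proof.
move=> pp pq ltpq.
have n0 : (0 < p * q ^ b.+1)%N by rewrite muln_gt0 expn_gt0 !prime_gt0.
have [[f fdvd fB] Bmax] := B_spec n0.
have [f1 [R [f1dvd [L RL] fE]]] := dvd_Xn_sub1_split pp pq ltpq fdvd.
exists R; apply/eqP; rewrite eqn_leq; apply/andP; split.
  by rewrite -fB fE; apply/height_class_bound/class_bound_dvd_Xpq_sub1.
apply: leq_trans (leq_height_PhipPhiq R pp pq ltpq) _; apply: Bmax.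
exists ('Phi_p * 'Phi_q * (R \Po 'X^q)) => //.
(* Substituting x^q into x^(p q^b) - 1 = (x^p - 1) R L gives (x^(pq) - 1) R(x^q) L(x^q); this
   cofactor collects what ['Phi_p * 'Phi_q] and R(x^q) leave. *)
exists ('Phi_1 * 'Phi_(p * q) * (L \Po 'X^q)).
rewrite expnSr mulnA -Xn_sub1_comp RL !comp_polyM Xn_sub1_comp.
by rewrite prod_Cyclotomic_primeM //; ring.
Qed.

Close Scope ring_scope.

Theorem theorem1p4 (p q b : nat) (hp : prime p) (hq : prime q) (hpq : p < q)
  (hb : 0 < b) : p %| B (p * q ^ b).
Proof.
case: b hb => // b _; have [R ->] := B_eq_height b hp hq hpq.
exact: dvdn_mulr.
Qed.
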